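(* Let $X$, $Y$ and $Z$ be metric spaces, let $s_1, s_2, r \ge 0$, and let $f, g : X \to Y$ be $(s_1, r)$-homotopic maps. Let $h, h' : Z \to X$ be any $s_2$-Lipschitz maps. Then $$D^{(s_1 s_2)}_{(s_1+1)r}(f \circ h, g \circ h') \le D^{(s_2)}_r(h, h').$$
   Context: For a non-negative integer $m$, $[m] = \{0, 1, \dots, m\}$ carries the metric $d(a,b) = |a-b|$. For $s \ge 0$, a map $\varphi$ between metric spaces is $s$-Lipschitz if $d(\varphi(x), \varphi(x')) \le s\, d(x,x')$ for all $x,x'$. For $s, r \ge 0$ and maps $f, g : X \to Y$ between metric spaces, an $(s,r)$-homotopy between $f$ and $g$ is a map $F : X \times [m] \to Y$, for some non-negative integer $m$, such that (1) $F(x,-) : [m] \to Y$ is $r$-Lipschitz for every $x \in X$; (2) $F(-,i) : X \to Y$ is $s$-Lipschitz for every $i \in [m]$; (3) $F(x,0) = f(x)$ and $F(x,m) = g(x)$ for all $x \in X$. One writes $f \simeq_{(s,r)} g$, and says $f$ and $g$ are $(s,r)$-homotopic, if such an $F$ exists (in particular $f$ and $g$ are then $s$-Lipschitz). For two $s$-Lipschitz maps $f,g : X \to Y$, the discrete homotopic distance $D^{(s)}_r(f,g)$ is the smallest integer $k \ge 0$ for which there is an open cover $U_0, \dots, U_k$ of $X$ with $f|_{U_i} \simeq_{(s,r)} g|_{U_i}$ (as maps $U_i \to Y$) for all $i = 0, \dots, k$; it is $\infty$ if no such cover exists. *)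

(* Defs.v *)
From HB Require Import structures.
From mathcomp Require Import all_boot all_order all_algebra.
From mathcomp Require Import all_classical all_reals all_analysis.

Set Implicit Arguments.
Unset Strict Implicit.
Unset Printing Implicit Defensive.

Import Order.TTheory GRing.Theory Num.Theory.

Local Open Scope classical_set_scope.
Local Open Scope ring_scope.

(* The subspace metric on a subset; [set_type A] already carries the
   corresponding pseudometric structure, with balls pulled back along set_val. *)
Section set_type_metric.
Context {R : realType} {X : metricType R} (A : set X).

Let dist (x y : A) : R := mdist (set_val x) (set_val y).

Let dist_ge0 x y : 0 <= dist x y.
Proof. exact: mdist_ge0. Qed.

Let dist_positivity x y : dist x y = 0 -> x = y.
Proof. by move=> /mdist_positivity/val_inj. Qed.

Let dist_ballE (x : A) (e : R) : ball x e = [set y | dist x y < e].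
Proof.
by apply/seteqP; split => y; rewrite /ball/= /initial_ball ballEmdist.
Qed.

HB.instance Definition _ := @PseudoMetric_isMetric.Build R (set_type A)
  dist dist_ge0 dist_positivity dist_ballE.

Lemma mdist_set_typeE (x y : set_type A) :
  mdist x y = mdist (set_val x) (set_val y).
Proof. by []. Qed.

End set_type_metric.

(* [m] = {0, ..., m} with d(a, b) = |a - b|. The phantom parameter R is the
   field in which distances are measured. *)
Definition segment (R : realType) (m : nat) : Type := 'I_m.+1.

Section segment_metric.
Context (R : realType) (m : nat).

HB.instance Definition _ := Choice.copy (segment R m) 'I_m.+1.

Let dist (a b : segment R m) : R := `|(a : 'I_m.+1)%:R - (b : 'I_m.+1)%:R|.

Let distxx a : dist a a = 0.
Proof. by rewrite /dist subrr normr0. Qed.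

Let dist_positivity a b : dist a b = 0 -> a = b.
Proof.
move=> /normr0_eq0/eqP; rewrite subr_eq0 eqr_nat => /eqP ab.
exact: ord_inj.
Qed.

Let dist_sym a b : dist a b = dist b a.
Proof. exact: distrC. Qed.

Let dist_triangle b a c : dist a c <= dist a b + dist b c.
Proof. exact: ler_distD. Qed.

HB.instance Definition _ := @isMetric.Build R (segment R m)
  dist distxx dist_positivity dist_sym dist_triangle.

Lemma mdist_segmentE (a b : segment R m) :
  mdist a b = `|(a : 'I_m.+1)%:R - (b : 'I_m.+1)%:R|.
Proof. by []. Qed.

End segment_metric.

Section homotopic_distance.
Context {R : realType}.

Definition lipschitz_map (X Y : metricType R) (s : R) (f : X -> Y) : Prop :=
  forall x x' : X, mdist (f x) (f x') <= s * mdist x x'.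

Definition is_homotopy (X Y : metricType R) (s r : R) (f g : X -> Y) (m : nat)
    (F : X -> segment R m -> Y) : Prop :=
  [/\ forall x : X, lipschitz_map r (F x),
      forall i : segment R m, lipschitz_map s (fun x : X => F x i),
      forall x : X, F x (ord0 : 'I_m.+1) = f x
    & forall x : X, F x (ord_max : 'I_m.+1) = g x].

Definition homotopic (X Y : metricType R) (s r : R) (f g : X -> Y) : Prop :=
  exists (m : nat) (F : X -> segment R m -> Y), is_homotopy s r f g F.

Definition restrict_to (X Y : Type) (U : set X) (f : X -> Y) : U -> Y :=
  fun x => f (set_val x).

Definition homotopic_cover (X Y : metricType R) (s r : R) (f g : X -> Y)
    (k : nat) : Prop :=
  exists U : 'I_k.+1 -> set X,
    [/\ forall i, open (U i),
        \bigcup_(i in [set: 'I_k.+1]) U i = [set: X]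
      & forall i, homotopic s r (restrict_to (U := U i) f)
                                (restrict_to (U := U i) g)].

Definition homotopic_distance (X Y : metricType R) (s r : R) (f g : X -> Y) :
    \bar R :=
  if pselect (exists k, `[< homotopic_cover s r f g k >]) is left exk
  then ((ex_minn exk)%:R)%:E else +oo%E.

End homotopic_distance.

(* Main.v *)
Require Import Defs.
From HB Require Import structures.
From mathcomp Require Import all_boot all_order all_algebra.
From mathcomp Require Import all_classical all_reals all_analysis.

Import Order.TTheory GRing.Theory Num.Theory.
Local Open Scope classical_set_scope.
Local Open Scope ring_scope.

(** Homotopies compose: if [F] is an (s1, r)-homotopy from [f] to [g] and [H]
    an (s2, r)-homotopy from [h] to [h'], run both at once along the diagonal,
    [(z, k) |-> F (H z k) k], after prolonging the shorter of the two by
    constancy so that they last equally long. In one unit of time the time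
    argument of [F] costs at most [r], and the motion of [H z k], of length at
    most [r], is stretched by [F] into at most [s1 * r]; this is where the
    constant [(s1 + 1) * r] comes from ([homotopic_comp]).

    Composition is compatible with restriction to a subset of the source of
    [h] and [h'], so an open cover on whose members [h] and [h'] are homotopic
    also serves [f \o h] and [g \o h']. More covers available means a smaller
    distance ([le_homotopic_distance]). *)

(** A reparametrization of time: for [m <= n], precomposition with it turns a
    homotopy lasting [m] into one lasting [n] that rests once [m] is reached. *)
Definition clamp {R : realType} {n : nat} (m : nat) (k : segment R n) :
    segment R m :=
  (inord (minn (k : 'I_n.+1) m) : 'I_m.+1).

Lemma lipschitz_clamp (R : realType) (n m : nat) :
  lipschitz_map 1 (@clamp R n m).
Proof.
move=> k l; rewrite mul1r !mdist_segmentE /clamp !inordK ?ltnS ?geq_minr//.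
wlog lelk : k l / ((l : 'I_n.+1) <= (k : 'I_n.+1))%N.
  move=> th; have [lk|/ltnW kl] := leqP (l : 'I_n.+1) (k : 'I_n.+1).
    exact: th.
  by rewrite distrC [leRHS]distrC; exact: th.
rewrite -!natrB ?leq_min ?geq_minr ?andbT//; last first.
  by rewrite (leq_trans _ lelk)// geq_minl.
rewrite !normr_nat ler_nat leq_subLR.
have [lm|/ltnW ml] := leqP (l : 'I_n.+1) m.
  by rewrite subnKC// geq_minl.
by rewrite (leq_trans (geq_minr _ _))// leq_addr.
Qed.

Lemma lipschitz_comp {R : realType} {X Y Z : metricType R} {s t : R}
    {f : X -> Y} {h : Z -> X} : 0 <= s ->
  lipschitz_map s f -> lipschitz_map t h -> lipschitz_map (s * t) (f \o h).
Proof.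
move=> s0 lf lh z z'; rewrite -mulrA.
by rewrite (le_trans (lf _ _))// ler_wpM2l.
Qed.

Lemma clamp0 (R : realType) (n m : nat) :
  @clamp R n m (ord0 : 'I_n.+1) = (ord0 : 'I_m.+1).
Proof. by apply: ord_inj; rewrite /clamp inordK min0n. Qed.

Lemma clamp_max (R : realType) (n m : nat) : (m <= n)%N ->
  @clamp R n m (ord_max : 'I_n.+1) = (ord_max : 'I_m.+1).
Proof. by move=> mn; apply: ord_inj; rewrite /clamp inordK (minn_idPr mn). Qed.

(** The homotopy advances in both time arguments at once, so the costs [r] and
    [s1 * r] add up, whereas in space only the Lipschitz constants multiply. *)
Lemma homotopic_comp {R : realType} {X Y Z : metricType R} {s1 s2 r : R}
    {f g : X -> Y} {h h' : Z -> X} : 0 <= s1 -> 0 <= r ->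
  homotopic s1 r f g -> homotopic s2 r h h' ->
  homotopic (s1 * s2) ((s1 + 1) * r) (f \o h) (g \o h').
Proof.
move=> s10 r0 [m [F [Ftime Fspace F0 F1]]] [n [H [Htime Hspace H0 H1]]].
pose N := maxn m n.
exists N, (fun z k => F (H z (clamp n k)) (clamp m k)).
split=> [z k l|k|z|z].
- have Fclamp x : lipschitz_map r (F x \o @clamp R N m).
    by rewrite -[r]mulr1; apply: lipschitz_comp => //; exact: lipschitz_clamp.
  have Hclamp : lipschitz_map r (H z \o @clamp R N n).
    by rewrite -[r]mulr1; apply: lipschitz_comp => //; exact: lipschitz_clamp.
  (* Move the point of [X] first, at a fixed time of [F], and then the time. *)
  apply: le_trans
    (metric_triangle _ (F (H z (clamp n l)) (clamp m k)) _) _.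
  rewrite !mulrDl mul1r lerD ?Fclamp//.
  exact: (lipschitz_comp s10 (Fspace (clamp m k)) Hclamp).
- exact: (lipschitz_comp s10 (Fspace _) (Hspace _)).
- by rewrite !clamp0 H0 F0.
- by rewrite !clamp_max ?leq_maxl ?leq_maxr// H1 F1.
Qed.

Lemma le_homotopic_distance (R : realType) (X Y X' Y' : metricType R)
    (s r s' r' : R) (f g : X -> Y) (f' g' : X' -> Y') :
  (forall k, homotopic_cover s' r' f' g' k -> homotopic_cover s r f g k) ->
  (homotopic_distance s r f g <= homotopic_distance s' r' f' g')%E.
Proof.
move=> cov; rewrite /homotopic_distance.
case: pselect => [exk|nexk]; case: pselect => [exk'|nexk'].
- rewrite lee_fin ler_nat; case: ex_minnP => k _; apply.
  by case: ex_minnP => k' /asboolP covk' _; apply/asboolP/cov.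
- exact: leey.
- by case: nexk; have [k /asboolP/cov ?] := exk'; exists k; apply/asboolP.
- exact: lexx.
Qed.

Theorem proposition4p8 (R : realType) (X Y Z : metricType R) (s1 s2 r : R)
    (hs1 : 0 <= s1) (hs2 : 0 <= s2) (hr : 0 <= r)
    (f g : X -> Y) (hfg : homotopic s1 r f g)
    (h h' : Z -> X) (hh : lipschitz_map s2 h) (hh' : lipschitz_map s2 h') :
  (homotopic_distance (s1 * s2) ((s1 + 1) * r) (f \o h) (g \o h')
     <= homotopic_distance s2 r h h')%E.
Proof.
apply: le_homotopic_distance => k [U [openU coverU homU]].
exists U; split=> // i.
exact: (homotopic_comp hs1 hr hfg (homU i)).
Qed.
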